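(* (Scott's Representation Theorem) Any $\lambda$-theory is isomorphic, as a $\lambda$-theory, to the endomorphism $\lambda$-theory of a reflexive object in a cartesian closed category.
   Context: **Algebraic theories.** $\mathbf F$ is the category with objects the finite sets $n=\{1,\dots,n\}$ and all functions. An algebraic theory $\mathcal T$ is a functor $\mathcal T:\mathbf F\to\mathbf{Sets}$ with projections $\mathbf{pr}_1,\dots,\mathbf{pr}_n\in\mathcal T(n)$ (in particular $\mathbf{id}=\mathbf{pr}_1\in\mathcal T(1)$) and compositions $\mathcal T(n)\times\mathcal T(m)^n\to\mathcal T(m)$, $(f,g_1,\dots,g_n)\mapsto f(g_1,\dots,g_n)$, satisfying associativity, $f(\mathbf{pr}_1,\dots,\mathbf{pr}_n)=f$, $\mathbf{pr}_i(g_1,\dots,g_n)=g_i$, and $\mathcal T(\varphi)(f)=f(\mathbf{pr}_{\varphi(1)},\dots,\mathbf{pr}_{\varphi(n)})$ for $\varphi:n\to m$. A map of algebraic theories is a natural transformation preserving projections and composition. **$\lambda$-theories.** A $\lambda$-theory is an algebraic theory $\mathcal L$ equipped with semi-closed structure: maps $\rho:\mathcal L(n)\to\mathcal L(n+1)$ and $\lambda:\mathcal L(n+1)\to\mathcal L(n)$ with $\rho\circ\lambda=\mathrm{id}$, natural in $n$ and compatible with the actions $\mathcal L(m)\times\mathcal L(n)^m\to\mathcal L(n)$ (composition) and $\mathcal L(m+1)\times\mathcal L(n)^m\to\mathcal L(n+1)$, the latter being $(s,g_1,\dots,g_m)\mapsto s(g_1,\dots,g_m,\mathbf{pr}_{n+1})$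 with the $g_i$ weakened to $\mathcal L(n+1)$. A map of $\lambda$-theories is a map of algebraic theories commuting with $\rho$ and $\lambda$. **Reflexive objects.** A reflexive object in a cartesian closed category $\mathbf C$ is an object $U$ equipped with a retraction of $U$ onto the function space $U^U$, i.e. maps $r:U\to U^U$ and $i:U^U\to U$ with $r\circ i=\mathrm{id}$. Its endomorphism $\lambda$-theory $\mathcal U$ has $\mathcal U(n)=\mathbf C(U^n,U)$, with product projections as projections, composition $(f,g_1,\dots,g_n)\mapsto f\circ\langle g_1,\dots,g_n\rangle$, and with $\rho:\mathcal U(n)\to\mathcal U(n+1)$ and $\lambda:\mathcal U(n+1)\to\mathcal U(n)$ obtained from composition with $r$ and $i$ respectively via the isomorphism $\mathbf C(U^n,U^U)\cong\mathbf C(U^{n+1},U)$. *)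

(* Defs.v *)
(* Sets are rendered as types with Leibniz equality, and an n-tuple of elements
   of A as a function 'I_n -> A; functional extensionality (not needed in this
   file) identifies pointwise equal tuples. *)
From mathcomp Require Import all_boot.

Set Implicit Arguments.
Unset Strict Implicit.
Unset Printing Implicit Defensive.

(* (a_1, ..., a_n, b): the new entry comes last, and lift ord_max is the
   inclusion of {1, ..., n} into {1, ..., n+1}. *)
Definition snoc (n : nat) (A : Type) (a : 'I_n -> A) (b : A) : 'I_n.+1 -> A :=
  fun i => match unlift ord_max i with Some j => a j | None => b end.

Definition incl (n : nat) : 'I_n -> 'I_n.+1 := lift ord_max.

(* phi + 1 : n + 1 -> m + 1 *)
Definition fsucc (n m : nat) (phi : 'I_n -> 'I_m) : 'I_n.+1 -> 'I_m.+1 :=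
  snoc (fun i => incl (phi i)) ord_max.

Record algebraic_theory : Type := AlgebraicTheory {
  op :> nat -> Type;
  act : forall n m : nat, ('I_n -> 'I_m) -> op n -> op m;
  act_id : forall (n : nat) (f : op n), act (fun i => i) f = f;
  act_comp : forall (n m k : nat) (psi : 'I_m -> 'I_k) (phi : 'I_n -> 'I_m)
    (f : op n), act (fun i => psi (phi i)) f = act psi (act phi f);
  pr : forall n : nat, 'I_n -> op n;
  subst : forall n m : nat, op n -> ('I_n -> op m) -> op m;
  subst_assoc : forall (n m k : nat) (f : op n) (g : 'I_n -> op m)
    (h : 'I_m -> op k),
    subst (subst f g) h = subst f (fun i => subst (g i) h);
  subst_pr : forall (n : nat) (f : op n), subst f (@pr n) = f;
  pr_subst : forall (n m : nat) (i : 'I_n) (g : 'I_n -> op m),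
    subst (pr i) g = g i;
  act_subst : forall (n m : nat) (phi : 'I_n -> 'I_m) (f : op n),
    act phi f = subst f (fun i => pr (phi i))
}.
Arguments act a {n m} phi f.
Arguments pr a {n} i.
Arguments subst a {n m} f g.

Record theory_map (S T : algebraic_theory) : Type := TheoryMap {
  tmap :> forall n : nat, S n -> T n;
  tmap_act : forall (n m : nat) (phi : 'I_n -> 'I_m) (f : S n),
    tmap (act S phi f) = act T phi (tmap f);
  tmap_pr : forall (n : nat) (i : 'I_n), tmap (pr S i) = pr T i;
  tmap_subst : forall (n m : nat) (f : S n) (g : 'I_n -> S m),
    tmap (subst S f g) = subst T (tmap f) (fun i => tmap (g i))
}.

(* (g_1, ..., g_m, pr_{n+1}) with the g_i weakened to T (n + 1); substitution
   along it is the action T (m + 1) x T (n)^m -> T (n + 1). *)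
Definition under (T : algebraic_theory) (m n : nat) (g : 'I_m -> T n) :
    'I_m.+1 -> T n.+1 :=
  snoc (fun i => act T (@incl n) (g i)) (pr T ord_max).

Record lambda_theory : Type := LambdaTheory {
  lt_theory :> algebraic_theory;
  rho : forall n : nat, lt_theory n -> lt_theory n.+1;
  lam : forall n : nat, lt_theory n.+1 -> lt_theory n;
  rho_lam : forall (n : nat) (s : lt_theory n.+1), rho (lam s) = s;
  rho_nat : forall (m n : nat) (phi : 'I_m -> 'I_n) (f : lt_theory m),
    rho (act lt_theory phi f) = act lt_theory (fsucc phi) (rho f);
  lam_nat : forall (m n : nat) (phi : 'I_m -> 'I_n) (s : lt_theory m.+1),
    lam (act lt_theory (fsucc phi) s) = act lt_theory phi (lam s);
  rho_subst : forall (m n : nat) (f : lt_theory m) (g : 'I_m -> lt_theory n),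
    rho (subst lt_theory f g) = subst lt_theory (rho f) (under g);
  lam_subst : forall (m n : nat) (s : lt_theory m.+1) (g : 'I_m -> lt_theory n),
    lam (subst lt_theory s (under g)) = subst lt_theory (lam s) g
}.
Arguments rho l {n} f.
Arguments lam l {n} s.

Record lambda_map (L M : lambda_theory) : Type := LambdaMap {
  lmap :> theory_map L M;
  lmap_rho : forall (n : nat) (f : L n), lmap n.+1 (rho L f) = rho M (lmap n f);
  lmap_lam : forall (n : nat) (s : L n.+1), lmap n (lam L s) = lam M (lmap n.+1 s)
}.

Definition lambda_isomorphic (L M : lambda_theory) : Prop :=
  exists (F : lambda_map L M) (G : lambda_map M L),
    (forall (n : nat) (f : L n), G n (F n f) = f) /\
    (forall (n : nat) (f : M n), F n (G n f) = f).

Record category : Type := Category {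
  obj :> Type;
  hom : obj -> obj -> Type;
  idm : forall X : obj, hom X X;
  comp : forall X Y Z : obj, hom Y Z -> hom X Y -> hom X Z;
  compA : forall (X Y Z W : obj) (h : hom Z W) (g : hom Y Z) (f : hom X Y),
    comp h (comp g f) = comp (comp h g) f;
  comp1m : forall (X Y : obj) (f : hom X Y), comp (idm Y) f = f;
  compm1 : forall (X Y : obj) (f : hom X Y), comp f (idm X) = f
}.
Arguments hom {c} X Y.
Arguments idm {c} X.
Arguments comp {c X Y Z} g f.

Notation "g \c f" := (comp g f) (at level 40, left associativity).

(* xpow X Y is the exponential X^Y. *)
Record ccc : Type := CCC {
  ccc_cat :> category;
  one : ccc_cat;
  bang : forall X : ccc_cat, hom X one;
  bang_uniq : forall (X : ccc_cat) (f : hom X one), f = bang X;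
  times : ccc_cat -> ccc_cat -> ccc_cat;
  p1 : forall X Y : ccc_cat, hom (times X Y) X;
  p2 : forall X Y : ccc_cat, hom (times X Y) Y;
  pairing : forall Z X Y : ccc_cat, hom Z X -> hom Z Y -> hom Z (times X Y);
  p1_pairing : forall (Z X Y : ccc_cat) (f : hom Z X) (g : hom Z Y),
    p1 X Y \c pairing f g = f;
  p2_pairing : forall (Z X Y : ccc_cat) (f : hom Z X) (g : hom Z Y),
    p2 X Y \c pairing f g = g;
  pairing_uniq : forall (Z X Y : ccc_cat) (f : hom Z X) (g : hom Z Y)
    (h : hom Z (times X Y)),
    p1 X Y \c h = f -> p2 X Y \c h = g -> h = pairing f g;
  xpow : ccc_cat -> ccc_cat -> ccc_cat;
  ev : forall X Y : ccc_cat, hom (times (xpow X Y) Y) X;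
  curry : forall Z X Y : ccc_cat, hom (times Z Y) X -> hom Z (xpow X Y);
  ev_curry : forall (Z X Y : ccc_cat) (f : hom (times Z Y) X),
    ev X Y \c pairing (curry f \c p1 Z Y) (p2 Z Y) = f;
  curry_uniq : forall (Z X Y : ccc_cat) (f : hom (times Z Y) X)
    (g : hom Z (xpow X Y)),
    ev X Y \c pairing (g \c p1 Z Y) (p2 Z Y) = f -> g = curry f
}.
Arguments one {c}.
Arguments bang {c} X.
Arguments times {c} X Y.
Arguments p1 {c X Y}.
Arguments p2 {c X Y}.
Arguments pairing {c Z X Y} f g.
Arguments xpow {c} X Y.
Arguments ev {c X Y}.
Arguments curry {c Z X Y} f.

Definition uncurry (C : ccc) (Z X Y : C) (g : hom Z (xpow X Y)) :
    hom (times Z Y) X :=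
  ev \c pairing (g \c p1) p2.

Record reflexive_object (C : ccc) : Type := ReflexiveObject {
  carrier :> C;
  retr : hom carrier (xpow carrier carrier);
  sect : hom (xpow carrier carrier) carrier;
  retr_sect : retr \c sect = idm (xpow carrier carrier)
}.

Section Powers.
Variables (C : ccc) (U : C).

(* U^0 = 1 and U^(n+1) = U^n x U *)
Fixpoint power (n : nat) : C :=
  match n with 0 => one | m.+1 => times (power m) U end.

Fixpoint proj (n : nat) : 'I_n -> hom (power n) U :=
  match n return 'I_n -> hom (power n) U with
  | 0 => fun i => False_rect _ (notF (ltn_ord i))
  | m.+1 => snoc (fun j : 'I_m => proj j \c p1) p2
  end.

Fixpoint tupling (X : C) (n : nat) : ('I_n -> hom X U) -> hom X (power n) :=
  match n return ('I_n -> hom X U) -> hom X (power n) with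
  | 0 => fun _ => bang X
  | m.+1 => fun g => pairing (tupling (fun j => g (incl j))) (g ord_max)
  end.

Lemma snoc_incl n A (a : 'I_n -> A) b i : snoc a b (incl i) = a i.
Proof. by rewrite /snoc /incl liftK. Qed.

Lemma snoc_max n A (a : 'I_n -> A) b : snoc a b ord_max = b.
Proof. by rewrite /snoc unlift_none. Qed.

Lemma proj_incl n (j : 'I_n) : proj (incl j) = proj j \c p1.
Proof. exact: snoc_incl. Qed.

Lemma proj_max n : proj (@ord_max n) = p2.
Proof. exact: snoc_max. Qed.

Lemma proj_tupling X n (g : 'I_n -> hom X U) i : proj i \c tupling g = g i.
Proof.
elim: n g i => [|n IHn] g i; first by case: i.
case: (unliftP ord_max i) => [j|] ->.
  by rewrite -/(incl j) proj_incl -compA p1_pairing IHn.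
by rewrite proj_max p2_pairing.
Qed.

Lemma tupling_uniq X n (g : 'I_n -> hom X U) (h : hom X (power n)) :
  (forall i, proj i \c h = g i) -> h = tupling g.
Proof.
elim: n g h => [|n IHn] g h hg /=; first exact: bang_uniq.
apply: pairing_uniq; last by rewrite -hg proj_max.
by apply: IHn => i; rewrite compA -proj_incl hg.
Qed.

Lemma tupling_comp X Y n (g : 'I_n -> hom X U) (h : hom Y X) :
  tupling g \c h = tupling (fun i => g i \c h).
Proof. by apply: tupling_uniq => i; rewrite compA proj_tupling. Qed.

Lemma tupling_proj n : tupling (@proj n) = idm (power n).
Proof. by symmetry; apply: tupling_uniq => i; rewrite compm1. Qed.

Lemma tupling_snoc X n (g : 'I_n -> hom X U) (h : hom X U) :
  tupling (snoc g h) = pairing (tupling g) h.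
Proof.
symmetry; apply: tupling_uniq => i.
case: (unliftP ord_max i) => [j|] ->.
  by rewrite -/(incl j) proj_incl -compA p1_pairing proj_tupling snoc_incl.
by rewrite proj_max p2_pairing snoc_max.
Qed.

Lemma eq_tupling X n (g h : 'I_n -> hom X U) :
  g =1 h -> tupling g = tupling h.
Proof. by move=> gh; apply: tupling_uniq => i; rewrite proj_tupling. Qed.

Definition endo_act (n m : nat) (phi : 'I_n -> 'I_m) (f : hom (power n) U) :
    hom (power m) U :=
  f \c tupling (fun i => proj (phi i)).

Definition endo_subst (n m : nat) (f : hom (power n) U)
    (g : 'I_n -> hom (power m) U) : hom (power m) U :=
  f \c tupling g.

Lemma endo_act_id n (f : hom (power n) U) : endo_act (fun i => i) f = f.
Proof. by rewrite /endo_act tupling_proj compm1. Qed.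

Lemma endo_act_comp n m k (psi : 'I_m -> 'I_k) (phi : 'I_n -> 'I_m)
    (f : hom (power n) U) :
  endo_act (fun i => psi (phi i)) f = endo_act psi (endo_act phi f).
Proof.
rewrite /endo_act -compA tupling_comp; congr (_ \c _).
by apply: eq_tupling => i; rewrite proj_tupling.
Qed.

Lemma endo_subst_assoc n m k (f : hom (power n) U)
    (g : 'I_n -> hom (power m) U) (h : 'I_m -> hom (power k) U) :
  endo_subst (endo_subst f g) h = endo_subst f (fun i => endo_subst (g i) h).
Proof. by rewrite /endo_subst -compA tupling_comp. Qed.

Lemma endo_subst_pr n (f : hom (power n) U) : endo_subst f (@proj n) = f.
Proof. by rewrite /endo_subst tupling_proj compm1. Qed.

Definition endo_theory : algebraic_theory :=
  @AlgebraicTheory (fun n => hom (power n) U) endo_act endo_act_id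
    endo_act_comp proj endo_subst endo_subst_assoc endo_subst_pr
    (fun n m i g => proj_tupling g i) (fun n m phi f => erefl).

Lemma tupling_under m n (g : 'I_m -> endo_theory n) :
  tupling (under g) = pairing (tupling g \c p1) p2.
Proof.
rewrite /under tupling_snoc [pr _ _]proj_max; congr (pairing _ _).
rewrite tupling_comp; apply: eq_tupling => i; congr (_ \c _).
by symmetry; apply: tupling_uniq => j; rewrite proj_incl.
Qed.

Lemma tupling_fsucc m n (phi : 'I_m -> 'I_n) :
  tupling (fun i => proj (fsucc phi i)) =
  pairing (tupling (fun i => proj (phi i)) \c p1) p2.
Proof.
symmetry; apply: tupling_uniq => i.
case: (unliftP ord_max i) => [j|] ->; rewrite ?proj_max ?p2_pairing.
  rewrite -/(incl j) /fsucc snoc_incl !proj_incl -compA p1_pairing compA.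
  by rewrite proj_tupling.
by rewrite /fsucc snoc_max proj_max.
Qed.

End Powers.

Section Exponentials.
Variables (C : ccc) (W Z X Y : C).

Lemma pairing_comp (f : hom Z X) (g : hom Z Y) (h : hom W Z) :
  pairing f g \c h = pairing (f \c h) (g \c h).
Proof. by apply: pairing_uniq; rewrite compA ?p1_pairing ?p2_pairing. Qed.

Lemma uncurry_comp (g : hom Z (xpow X Y)) (h : hom W Z) :
  uncurry (g \c h) = uncurry g \c pairing (h \c p1) p2.
Proof.
rewrite /uncurry -[RHS]compA; congr (_ \c _); symmetry.
apply: pairing_uniq; rewrite compA ?p1_pairing ?p2_pairing //.
by rewrite -[LHS]compA p1_pairing compA.
Qed.

Lemma uncurry_curry (f : hom (times Z Y) X) : uncurry (curry f) = f.
Proof. exact: ev_curry. Qed.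

End Exponentials.

Lemma curry_comp (C : ccc) (W Z X Y : C) (f : hom (times Z Y) X)
    (h : hom W Z) :
  curry (f \c pairing (h \c p1) p2) = curry f \c h.
Proof.
by symmetry; apply: curry_uniq; rewrite -/(uncurry _) uncurry_comp uncurry_curry.
Qed.

Section EndomorphismTheory.
Variables (C : ccc) (U : reflexive_object C).
Let E := endo_theory U.

Definition endo_rho (n : nat) (f : E n) : E n.+1 := uncurry (retr U \c f).

Definition endo_lam (n : nat) (s : E n.+1) : E n := sect U \c curry s.

Lemma endo_rho_lam n (s : E n.+1) : endo_rho (endo_lam s) = s.
Proof.
by rewrite /endo_rho /endo_lam compA retr_sect comp1m uncurry_curry.
Qed.

Lemma endo_rho_nat m n (phi : 'I_m -> 'I_n) (f : E m) :
  endo_rho (act E phi f) = act E (fsucc phi) (endo_rho f).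
Proof.
by rewrite /endo_rho /= /endo_act tupling_fsucc compA uncurry_comp.
Qed.

Lemma endo_lam_nat m n (phi : 'I_m -> 'I_n) (s : E m.+1) :
  endo_lam (act E (fsucc phi) s) = act E phi (endo_lam s).
Proof.
by rewrite /endo_lam /= /endo_act tupling_fsucc curry_comp compA.
Qed.

Lemma endo_rho_subst m n (f : E m) (g : 'I_m -> E n) :
  endo_rho (subst E f g) = subst E (endo_rho f) (under g).
Proof.
by rewrite /endo_rho /= /endo_subst tupling_under compA uncurry_comp.
Qed.

Lemma endo_lam_subst m n (s : E m.+1) (g : 'I_m -> E n) :
  endo_lam (subst E s (under g)) = subst E (endo_lam s) g.
Proof.
by rewrite /endo_lam /= /endo_subst tupling_under curry_comp compA.
Qed.

Definition endo_lambda_theory : lambda_theory :=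
  LambdaTheory endo_rho_lam endo_rho_nat endo_lam_nat endo_rho_subst
    endo_lam_subst.

End EndomorphismTheory.

(* Main.v *)
Require Import Defs.
From mathcomp Require Import all_boot.
From Stdlib Require Import FunctionalExtensionality ProofIrrelevance.

Set Implicit Arguments.
Unset Strict Implicit.
Unset Printing Implicit Defensive.

(** The category is that of presheaves on the Lawvere theory of [L], and the
    reflexive object is [L] itself, regarded as a presheaf.

    The Lawvere theory has the natural numbers as objects, and a map from [m]
    to [n] is an [n]-tuple of elements of [L m]; a presheaf on it is therefore
    a family of sets [P n] on which tuples of elements of [L] act by
    substitution. Like any presheaf category it is cartesian closed. The family
    [U n = L n] is the presheaf represented by [1], and, since [n] is the
    [n]-fold product of [1] in the Lawvere theory, the power [U^n] is the
    presheaf represented by [n] ([power_of_tupleK], [tuple_of_powerK]). So the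
    Yoneda lemma identifies the maps from [U^n] to [U] with the elements of
    [L n]: an element [f] corresponds to substitution into [f], and a map is
    recovered from its value at the generic tuple of projections
    ([term_of_mapK], [map_of_termK]).

    For the same reason, an element of [U^U] at stage [n] is a natural
    operation on [U] with [n] parameters, and is determined by its value at
    [n + 1] generic arguments, an element of [L (n + 1)] ([generic_value]).
    Under this identification [rho] and [lam] become maps between [U] and
    [U^U], their naturality is the compatibility of [rho] and [lam] with
    substitution, and [rho (lam s) = s] says that they form a retraction. The
    Yoneda bijections respect projections and composition by the substitution
    laws of [L], and they respect [rho] and [lam] because abstraction and
    application commute with substitution ([map_of_term_rho],
    [map_of_term_lam]). *)

(** * Tuples in an algebraic theory *)

Section Tuples.
Variable T : algebraic_theory.

Lemma eq_subst n m (f : T n) (g h : 'I_n -> T m) :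
  g =1 h -> subst T f g = subst T f h.
Proof. by move=> /functional_extensionality ->. Qed.

Lemma snocE n A (a : 'I_n -> A) (b : A) (c : 'I_n.+1 -> A) :
  (forall i, c (incl i) = a i) -> c ord_max = b -> c = snoc a b.
Proof.
move=> ca cb; apply: functional_extensionality => i.
case: (unliftP ord_max i) => [j|] ->; last by rewrite snoc_max.
by rewrite -/(incl j) snoc_incl.
Qed.

Definition weaken n : 'I_n -> T n.+1 := fun i => pr T (incl i).

Lemma subst_weaken n m (f : T n) (g : 'I_n -> T m) (y : T m) :
  subst T (act T (@incl n) f) (snoc g y) = subst T f g.
Proof.
rewrite act_subst subst_assoc; apply: eq_subst => i.
by rewrite pr_subst snoc_incl.
Qed.

Lemma subst_under_snoc n m k (g : 'I_n -> T m) (h : 'I_m -> T k) (y : T k) :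
  (fun i => subst T (under g i) (snoc h y)) =
  snoc (fun i => subst T (g i) h) y.
Proof.
apply: snocE => [i|]; rewrite /under.
  by rewrite snoc_incl subst_weaken.
by rewrite snoc_max pr_subst snoc_max.
Qed.

Lemma comp_tuple_pr n m (g : 'I_n -> T m) : (fun i => subst T (pr T i) g) = g.
Proof. by apply: functional_extensionality => i; rewrite pr_subst. Qed.

Lemma comp_pr_tuple n m (g : 'I_n -> T m) :
  (fun i => subst T (g i) (fun j => pr T j)) = g.
Proof. by apply: functional_extensionality => i; apply: subst_pr. Qed.

Lemma comp_tupleA n m k l (g : 'I_n -> T m) (h : 'I_m -> T k) (e : 'I_k -> T l) :
  (fun i => subst T (subst T (g i) h) e) =
  (fun i => subst T (g i) (fun j => subst T (h j) e)).
Proof. by apply: functional_extensionality => i; rewrite subst_assoc. Qed.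

End Tuples.

(** * The cartesian closed category of presheaves *)

(** A contravariant functor on the Lawvere theory of [T]; the tuple
    [g : 'I_n -> T m] is a map from [m] to [n], so it acts from [P n] to
    [P m]. *)
Record presheaf (T : algebraic_theory) : Type := Presheaf {
  stage :> nat -> Type;
  restr : forall n m : nat, stage n -> ('I_n -> T m) -> stage m;
  restr_id : forall (n : nat) (x : stage n), restr x (fun i => pr T i) = x;
  restr_comp : forall (n m k : nat) (x : stage n) (g : 'I_n -> T m)
    (h : 'I_m -> T k),
    restr (restr x g) h = restr x (fun i => subst T (g i) h)
}.
Arguments restr {T} P {n m} x g : rename.

Record presheaf_map (T : algebraic_theory) (P Q : presheaf T) : Type :=
  PresheafMap {
    pmap :> forall n : nat, P n -> Q n;
    pmap_restr : forall (n m : nat) (x : P n) (g : 'I_n -> T m),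
      pmap (restr P x g) = restr Q (pmap x) g
  }.

Section Presheaves.
Variable T : algebraic_theory.
Implicit Types P Q R : presheaf T.

Lemma presheaf_map_eq P Q (a b : presheaf_map P Q) :
  (forall n (x : P n), a n x = b n x) -> a = b.
Proof.
case: a b => [a aP] [b bP] /= ab.
have {}ab : a = b.
  apply: functional_extensionality_dep => n.
  exact: functional_extensionality.
by rewrite -{}ab in bP *; rewrite (proof_irrelevance _ aP bP).
Qed.

Definition presheaf_id P : presheaf_map P P :=
  @PresheafMap T P P (fun n x => x) (fun n m x g => erefl).

Lemma presheaf_comp_subproof P Q R (b : presheaf_map Q R)
    (a : presheaf_map P Q) n m (x : P n) (g : 'I_n -> T m) :
  b m (a m (restr P x g)) = restr R (b n (a n x)) g.
Proof. by rewrite !pmap_restr. Qed.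

Definition presheaf_comp P Q R (b : presheaf_map Q R) (a : presheaf_map P Q) :
    presheaf_map P R :=
  PresheafMap (presheaf_comp_subproof b a).

Definition presheaf_cat : category.
Proof.
by refine (@Category (presheaf T) (@presheaf_map T) presheaf_id presheaf_comp
             _ _ _) => *; apply: presheaf_map_eq.
Defined.

Definition presheaf_one : presheaf T.
Proof.
by refine (@Presheaf T (fun=> unit) (fun _ _ _ _ => tt) _ _) => // n [].
Defined.

Definition presheaf_bang P : presheaf_map P presheaf_one :=
  @PresheafMap T P presheaf_one (fun _ _ => tt) (fun _ _ _ _ => erefl).

Definition presheaf_times P Q : presheaf T.
Proof.
refine (@Presheaf T (fun n => P n * Q n)%type
          (fun n m x g => (restr P x.1 g, restr Q x.2 g)) _ _).
  by move=> n [x y] /=; rewrite !restr_id.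
by move=> n m k [x y] g h /=; rewrite !restr_comp.
Defined.

Definition presheaf_p1 P Q : presheaf_map (presheaf_times P Q) P :=
  @PresheafMap T (presheaf_times P Q) P (fun n x => x.1)
    (fun _ _ _ _ => erefl).

Definition presheaf_p2 P Q : presheaf_map (presheaf_times P Q) Q :=
  @PresheafMap T (presheaf_times P Q) Q (fun n x => x.2)
    (fun _ _ _ _ => erefl).

Definition presheaf_pairing R P Q (a : presheaf_map R P)
    (b : presheaf_map R Q) : presheaf_map R (presheaf_times P Q).
Proof.
refine (@PresheafMap T R (presheaf_times P Q) (fun n x => (a n x, b n x)) _).
by move=> n m x g /=; rewrite !pmap_restr.
Defined.

(** An element at stage [n] of the exponential is a map to [P] from the
    product of [Q] and the presheaf represented by [n], as the Yoneda lemma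
    dictates. *)
Record exp_stage P Q (n : nat) : Type := ExpStage {
  exp_fun :> forall m : nat, ('I_n -> T m) -> Q m -> P m;
  exp_restr : forall (m k : nat) (g : 'I_n -> T m) (y : Q m) (h : 'I_m -> T k),
    exp_fun (fun i => subst T (g i) h) (restr Q y h) =
    restr P (exp_fun g y) h
}.

Lemma exp_stage_eq P Q n (F G : exp_stage P Q n) :
  (forall m g y, F m g y = G m g y) -> F = G.
Proof.
case: F G => [F FP] [G GP] /= FG.
have {}FG : F = G.
  apply: functional_extensionality_dep => m.
  apply: functional_extensionality => g.
  exact: functional_extensionality.
by rewrite -{}FG in GP *; rewrite (proof_irrelevance _ FP GP).
Qed.

Definition exp_stage_restr P Q n m (F : exp_stage P Q n) (g : 'I_n -> T m) :
  exp_stage P Q m.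
Proof.
refine (@ExpStage P Q m (fun k h y => F k (fun i => subst T (g i) h) y) _).
by move=> k l h y e; rewrite -exp_restr comp_tupleA.
Defined.

Definition presheaf_xpow P Q : presheaf T.
Proof.
refine (@Presheaf T (exp_stage P Q) (@exp_stage_restr P Q) _ _).
  by move=> n F; apply: exp_stage_eq => m g y /=; rewrite comp_tuple_pr.
by move=> n m k F g h; apply: exp_stage_eq => l e y /=; rewrite comp_tupleA.
Defined.

Definition presheaf_ev P Q :
  presheaf_map (presheaf_times (presheaf_xpow P Q) Q) P.
Proof.
refine (@PresheafMap T (presheaf_times (presheaf_xpow P Q) Q) P
          (fun n x => x.1 n (fun i => pr T i) x.2) _).
by move=> n m [F y] g /=; rewrite -exp_restr comp_tuple_pr comp_pr_tuple.
Defined.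

Lemma curry_stage_subproof R P Q (a : presheaf_map (presheaf_times R Q) P) n
    (z : R n) m k (g : 'I_n -> T m) (y : Q m) (h : 'I_m -> T k) :
  a k (restr R z (fun i => subst T (g i) h), restr Q y h) =
  restr P (a m (restr R z g, y)) h.
Proof. by rewrite -pmap_restr /= restr_comp. Qed.

Definition presheaf_curry R P Q (a : presheaf_map (presheaf_times R Q) P) :
  presheaf_map R (presheaf_xpow P Q).
Proof.
refine (@PresheafMap T R (presheaf_xpow P Q)
          (fun n z => ExpStage (curry_stage_subproof a z)) _).
move=> n m z g; apply: exp_stage_eq => k h y /=.
by rewrite restr_comp.
Defined.

Definition presheaf_ccc : ccc.
Proof.
refine (@CCC presheaf_cat presheaf_one presheaf_bang _
          presheaf_times presheaf_p1 presheaf_p2 presheaf_pairing _ _ _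
          presheaf_xpow presheaf_ev presheaf_curry _ _).
- by move=> P a; apply: presheaf_map_eq => n x; case: (a n x).
- by move=> R P Q a b; apply: presheaf_map_eq.
- by move=> R P Q a b; apply: presheaf_map_eq.
- move=> R P Q _ _ c <- <-; apply: presheaf_map_eq => n x /=.
  by case: (c n x).
- move=> R P Q a; apply: presheaf_map_eq => n [z y] /=.
  by rewrite restr_id.
(* Evaluation only sees [b] at the identity tuple; naturality of [b] recovers
   its value at an arbitrary tuple [g], by restricting [z] along [g] first. *)
move=> R P Q _ b <-; apply: presheaf_map_eq => n z.
apply: exp_stage_eq => m g y /=.
by rewrite (pmap_restr b) /= comp_pr_tuple.
Defined.

(** The presheaf represented by [n]. *)
Definition representable (n : nat) : presheaf T.
Proof.
refine (@Presheaf T (fun m => 'I_n -> T m)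
          (fun m k g h => fun i => subst T (g i) h) _ _).
  by move=> m g; apply: comp_pr_tuple.
by move=> m k l g h e; apply: comp_tupleA.
Defined.

(** The presheaf represented by [1], with the tuples of length one replaced by
    their entry. *)
Definition self_presheaf : presheaf T :=
  @Presheaf T T (fun n m => @subst T n m) (@subst_pr T) (@subst_assoc T).

End Presheaves.

(** * Powers of the theory are representable *)

Section Yoneda.
Variable T : algebraic_theory.
Let C := presheaf_ccc T.
Let U : C := self_presheaf T.

Definition at_stage (P Q : C) (a : hom P Q) (n : nat) (x : stage P n) :
    stage Q n :=
  pmap a x.

Lemma at_stage_restr (P Q : C) (a : hom P Q) n m (x : stage P n)
    (g : 'I_n -> T m) :
  at_stage a (restr P x g) = restr Q (at_stage a x) g.
Proof. exact: pmap_restr. Qed.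

Lemma at_stage_comp (P Q R : C) (b : hom Q R) (a : hom P Q) n (x : stage P n) :
  at_stage (b \c a) x = at_stage b (at_stage a x).
Proof. by []. Qed.

Definition tuple_of_power n m (t : stage (power U n) m) : 'I_n -> T m :=
  fun i => at_stage (proj U i) t.

Lemma tuple_of_power_restr n m k (t : stage (power U n) m) (g : 'I_m -> T k) :
  tuple_of_power (restr (power U n) t g) =
  (fun i => subst T (tuple_of_power t i) g).
Proof.
apply: functional_extensionality => i.
exact: (at_stage_restr (proj U i) t g).
Qed.

Lemma tuple_of_power_snoc n m (t : stage (power U n) m) (u : T m) :
  tuple_of_power (n := n.+1) (t, u) = snoc (tuple_of_power t) u.
Proof.
apply: snocE => [i|]; first by rewrite /tuple_of_power proj_incl.
by rewrite /tuple_of_power proj_max.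
Qed.

Lemma tuple_of_power_tupling (P : C) n m (a : 'I_n -> hom P U)
    (x : stage P m) :
  tuple_of_power (at_stage (tupling a) x) = (fun i => at_stage (a i) x).
Proof.
apply: functional_extensionality => i.
by rewrite /tuple_of_power -at_stage_comp proj_tupling.
Qed.

Definition entry n (i : 'I_n) : hom (representable T n : C) U :=
  @PresheafMap T (representable T n) U (fun m g => g i)
    (fun _ _ _ _ => erefl).

Definition power_of_tuple n m (g : 'I_n -> T m) : stage (power U n) m :=
  at_stage (tupling (@entry n)) (g : stage (representable T n) m).

Lemma power_of_tupleK n m (g : 'I_n -> T m) :
  tuple_of_power (power_of_tuple g) = g.
Proof. by rewrite tuple_of_power_tupling. Qed.

Definition tuple_map n : hom (power U n) (representable T n : C) :=
  @PresheafMap T (power U n) (representable T n) (@tuple_of_power n)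
    (@tuple_of_power_restr n).

Lemma tuple_of_powerK n m (t : stage (power U n) m) :
  power_of_tuple (tuple_of_power t) = t.
Proof.
have -> : power_of_tuple (tuple_of_power t) =
    at_stage (tupling (@entry n) \c tuple_map n) t by [].
have <- : idm (power U n) = tupling (@entry n) \c tuple_map n.
  rewrite tupling_comp; apply: tupling_uniq => i; rewrite compm1.
  exact: presheaf_map_eq.
by [].
Qed.

Lemma power_of_tuple_restr n m k (g : 'I_n -> T m) (h : 'I_m -> T k) :
  restr (power U n) (power_of_tuple g) h =
  power_of_tuple (fun i => subst T (g i) h).
Proof. by rewrite /power_of_tuple -at_stage_restr. Qed.

Lemma map_of_term_subproof n (f : T n) m k (t : stage (power U n) m)
    (g : 'I_m -> T k) :
  subst T f (tuple_of_power (restr (power U n) t g)) =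
  subst T (subst T f (tuple_of_power t)) g.
Proof. by rewrite tuple_of_power_restr subst_assoc. Qed.

Definition map_of_term n (f : T n) : hom (power U n) U :=
  @PresheafMap T (power U n) U (fun m t => subst T f (tuple_of_power t))
    (map_of_term_subproof f).

Definition term_of_map n (a : hom (power U n) U) : T n :=
  at_stage a (power_of_tuple (fun i => pr T i)).

Lemma map_of_termK n (f : T n) : term_of_map (map_of_term f) = f.
Proof.
by rewrite /term_of_map /at_stage /= power_of_tupleK; apply: subst_pr.
Qed.

(** This is naturality of [a], since any element of [U^n] is the restriction, along its own
    entries, of the generic tuple of projections. *)
Lemma term_of_mapK n (a : hom (power U n) U) : map_of_term (term_of_map a) = a.
Proof.
apply: presheaf_map_eq => m t /=.
have -> : subst T (term_of_map a) (tuple_of_power t) =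
    restr U (term_of_map a) (tuple_of_power t) by [].
by rewrite -at_stage_restr power_of_tuple_restr comp_tuple_pr tuple_of_powerK.
Qed.

Lemma map_of_term_pr n (i : 'I_n) : map_of_term (pr T i) = proj U i.
Proof. by apply: presheaf_map_eq => m t /=; rewrite pr_subst. Qed.

Lemma map_of_term_subst n m (f : T n) (g : 'I_n -> T m) :
  map_of_term (subst T f g) =
  map_of_term f \c tupling (fun i => map_of_term (g i)).
Proof.
apply: presheaf_map_eq => k t /=.
rewrite subst_assoc; congr (subst T f _); symmetry.
exact: (tuple_of_power_tupling (fun i => map_of_term (g i)) t).
Qed.

Lemma map_of_term_act n m (phi : 'I_n -> 'I_m) (f : T n) :
  map_of_term (act T phi f) =
  map_of_term f \c tupling (fun i => proj U (phi i)).
Proof.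
rewrite act_subst map_of_term_subst; congr (_ \c _).
by apply: eq_tupling => i; apply: map_of_term_pr.
Qed.

Definition map_of_term_theory_map : theory_map T (endo_theory U) :=
  @TheoryMap T (endo_theory U) map_of_term map_of_term_act map_of_term_pr
    map_of_term_subst.

End Yoneda.

(** * The reflexive object *)

Section ReflexiveObject.
Variable L : lambda_theory.
Let C := presheaf_ccc L.
Let U : C := self_presheaf L.

(** Through [generic_value] this is [rho] ([subst_generic_value] shows that an
    operation is substitution into its generic value). *)
Definition application n (f : L n) : stage (xpow U U) n.
Proof.
refine (@ExpStage L (self_presheaf L) (self_presheaf L) n
          (fun m g y => subst L (rho L f) (snoc g y)) _).
move=> m k g y h /=; rewrite subst_assoc; apply: eq_subst => i.
case: (unliftP ord_max i) => [j|] ->; last by rewrite !snoc_max.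
by rewrite -/(incl j) !snoc_incl.
Defined.

Lemma application_restr n m (f : L n) (g : 'I_n -> L m) :
  application (subst L f g) = restr (xpow U U) (application f) g.
Proof.
apply: exp_stage_eq => k h y /=.
by rewrite rho_subst subst_assoc subst_under_snoc.
Qed.

(** [U^U] is the presheaf [n |-> L n.+1]: by the Yoneda lemma an element of it
    at stage [n], being a map to [U] from the presheaf represented by
    [n + 1], is its value at the generic arguments. *)
Definition generic_value n (F : stage (xpow U U) n) : L n.+1 :=
  exp_fun F (@weaken L n) (pr L ord_max).

Lemma subst_generic_value n (F : stage (xpow U U) n) m (g : 'I_n -> L m)
    (y : L m) :
  subst L (generic_value F) (snoc g y) = exp_fun F g y.
Proof.
have -> : subst L (generic_value F) (snoc g y) =
    restr U (generic_value F) (snoc g y) by [].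
rewrite -exp_restr /= pr_subst snoc_max; congr (exp_fun F _ _).
by apply: functional_extensionality => i; rewrite pr_subst snoc_incl.
Qed.

Lemma generic_value_restr n m (F : stage (xpow U U) n) (g : 'I_n -> L m) :
  generic_value (restr (xpow U U) F g) =
  subst L (generic_value F) (under g).
Proof.
rewrite subst_generic_value; congr (exp_fun F _ _).
by apply: functional_extensionality => i; rewrite act_subst.
Qed.

Lemma abstraction_restr n m (F : stage (xpow U U) n) (g : 'I_n -> L m) :
  lam L (generic_value (restr (xpow U U) F g)) =
  subst L (lam L (generic_value F)) g.
Proof. by rewrite generic_value_restr lam_subst. Qed.

Definition application_map : hom U (xpow U U) :=
  @PresheafMap L U (xpow U U) application application_restr.

Definition abstraction_map : hom (xpow U U) U :=
  @PresheafMap L (xpow U U) U (fun n F => lam L (generic_value F))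
    abstraction_restr.

Lemma application_abstraction :
  application_map \c abstraction_map = idm (xpow U U).
Proof.
apply: presheaf_map_eq => n F; apply: exp_stage_eq => m g y /=.
by rewrite rho_lam subst_generic_value.
Qed.

Definition self_reflexive : reflexive_object C :=
  ReflexiveObject application_abstraction.

(** * The isomorphism of lambda-theories *)

Lemma map_of_term_rho n (f : L n) :
  map_of_term (rho L f) =
  endo_rho (U := self_reflexive) (map_of_term f).
Proof.
apply: presheaf_map_eq => m [t u] /=.
by rewrite tuple_of_power_snoc rho_subst subst_assoc subst_under_snoc
           comp_pr_tuple.
Qed.

Lemma map_of_term_lam n (s : L n.+1) :
  map_of_term (lam L s) =
  endo_lam (U := self_reflexive) (map_of_term s).
Proof.
apply: presheaf_map_eq => m t /=.
rewrite -lam_subst /generic_value /=; congr (lam L _).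
rewrite tuple_of_power_snoc tuple_of_power_restr; congr (subst L s _).
rewrite /under; congr snoc.
by apply: functional_extensionality => i; rewrite act_subst.
Qed.

Definition map_of_term_lambda_map :
    lambda_map L (endo_lambda_theory self_reflexive) :=
  @LambdaMap L (endo_lambda_theory self_reflexive) (map_of_term_theory_map L)
    map_of_term_rho map_of_term_lam.

End ReflexiveObject.

(** As for any algebraic structure, the inverse of a bijective map preserves
    the operations, since these can be compared after applying the map. *)
Lemma bijective_lambda_isomorphic (L M : lambda_theory) (F : lambda_map L M)
    (G : forall n, M n -> L n) :
  (forall n f, G n (F n f) = f) -> (forall n f, F n (G n f) = f) ->
  lambda_isomorphic L M.
Proof.
move=> FK GK.
have F_inj n (x y : L n) : F n x = F n y -> x = y.
  by move=> Fxy; rewrite -[x]FK Fxy FK.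
have G_act n m (phi : 'I_n -> 'I_m) (f : M n) :
    G m (act M phi f) = act L phi (G n f).
  by apply: F_inj; rewrite tmap_act !GK.
have G_pr n (i : 'I_n) : G n (pr M i) = pr L i.
  by apply: F_inj; rewrite tmap_pr GK.
have G_subst n m (f : M n) (g : 'I_n -> M m) :
    G m (subst M f g) = subst L (G n f) (fun i => G m (g i)).
  apply: F_inj; rewrite tmap_subst !GK.
  by apply: eq_subst => i; rewrite GK.
have G_rho n (f : M n) : G n.+1 (rho M f) = rho L (G n f).
  by apply: F_inj; rewrite lmap_rho !GK.
have G_lam n (s : M n.+1) : G n (lam M s) = lam L (G n.+1 s).
  by apply: F_inj; rewrite lmap_lam !GK.
by exists F, (@LambdaMap M L (TheoryMap G_act G_pr G_subst) G_rho G_lam).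
Qed.

Theorem theorem3p10 (L : lambda_theory) :
  exists (C : ccc) (U : reflexive_object C),
    lambda_isomorphic L (endo_lambda_theory U).
Proof.
exists (presheaf_ccc L), (self_reflexive L).
apply: (@bijective_lambda_isomorphic L _ (map_of_term_lambda_map L)
          (@term_of_map L)).
- exact: map_of_termK.
- exact: term_of_mapK.
Qed.
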